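(* Let $R$ be a $\lambda$-ring and $x\in R$ a Schur-finite element with bound $(2,1)$. Then $R$ is contained (as a $\lambda$-subring) in a $\lambda$-ring $R'$ in which there are line elements $\ell_1,\ell_2,\ell_3$ with $x=\ell_1+\ell_2-\ell_3$.
   Context: $\lambda$-rings are special $\lambda$-rings. A line element is an element $\ell$ with $\lambda^n(\ell)=0$ for all $n>1$. For $x\in R$ and a partition $\pi$, $s_\pi(x)=u_x(s_\pi)$ where $u_x$ is the $\lambda$-ring map from the ring of symmetric functions $\Lambda$ to $R$ with $e_1\mapsto x$, $s_\pi$ being the Schur function. $x$ is Schur-finite with bound $\lambda$ if $s_\pi(x)=0$ for every partition $\pi$ whose Young diagram contains that of $\lambda$; bound $(2,1)$ means $s_\pi(x)=0$ for all $\pi$ with $\pi_1\ge2$ and at least two rows. *)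

(* Defs.v *)
From HB Require Import structures.
From mathcomp Require Import all_boot all_order all_algebra.
Set Implicit Arguments.
Unset Strict Implicit.
Unset Printing Implicit Defensive.
Import Order.TTheory GRing.Theory Num.Theory.
Local Open Scope ring_scope.

Definition esym (S : comNzRingType) (k : nat) (s : seq S) : S :=
  (\prod_(a <- s) (1 + a *: 'X))`_k.

Fixpoint sprods (S : comNzRingType) (n : nat) (s : seq S) {struct s} : seq S :=
  match s with
  | [::] => if n is 0 then [:: 1] else [::]
  | a :: s' => if n is n'.+1 then map (fun p => a * p) (sprods n' s') ++ sprods n s'
               else [:: 1]
  end.

Inductive lterm : Type :=
  | TX of nat
  | TY of nat
  | TC of int
  | TAdd of lterm & lterm
  | TMul of lterm & lterm.

Fixpoint leval (R : comNzRingType) (fx fy : nat -> R) (t : lterm) : R :=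
  match t with
  | TX k => fx k
  | TY k => fy k
  | TC z => z%:~R
  | TAdd t1 t2 => leval fx fy t1 + leval fx fy t2
  | TMul t1 t2 => leval fx fy t1 * leval fx fy t2
  end.

(* Q represents the universal polynomial P_n of the multiplication axiom:
   sum_n P_n(e(xi), e(eta)) t^n = prod_{i,j} (1 + xi_i eta_j t),
   i.e. Q(e_k(a) for X_k, e_k(b) for Y_k) = e_n(a_i b_j) identically. *)
Definition mul_univ (n : nat) (Q : lterm) : Prop :=
  forall (S : comNzRingType) (a b : seq S),
    esym n [seq u * v | u <- a, v <- b] =
    leval (fun k => esym k a) (fun k => esym k b) Q.

(* Q represents the universal polynomial P_{m,n} of the composition axiom:
   P_{m,n}(e(xi)) = coefficient of t^m in prod_{i1<..<in} (1 + xi_i1..xi_in t). *)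
Definition comp_univ (m n : nat) (Q : lterm) : Prop :=
  forall (S : comNzRingType) (a : seq S),
    esym m (sprods n a) = leval (fun k => esym k a) (fun _ => 0) Q.

Definition special_lambda (R : comNzRingType) (lam : nat -> R -> R) : Prop :=
  [/\ (forall x, lam 0%N x = 1) /\ (forall x, lam 1%N x = x),
      (forall n x y, lam n (x + y) = \sum_(i < n.+1) lam i x * lam (n - i)%N y),
      (forall n, lam n.+2 1 = 0),
      (forall n Q, mul_univ n Q -> forall x y,
        lam n (x * y) = leval (fun k => lam k x) (fun k => lam k y) Q) &
      (forall m n Q, comp_univ m n Q -> forall x,
        lam m (lam n x) = leval (fun k => lam k x) (fun _ => 0) Q)].

Definition line_elt (R : comNzRingType) (lam : nat -> R -> R) (l : R) : Prop :=
  forall n, (1 < n)%N -> lam n l = 0.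

Definition is_partition (p : seq nat) : bool :=
  sorted geq p && all (fun a => 0 < a)%N p.

Definition contains (p mu : seq nat) : bool :=
  (size mu <= size p)%N && all (fun i => nth 0%N mu i <= nth 0%N p i)%N (iota 0 (size mu)).

Definition conjp (p : seq nat) (i : nat) : nat := count (fun a => i <= a)%N p.

(* s_p(x) = u_x(s_p), written via the dual Jacobi-Trudi identity
   s_p = det (e_{p'_i - i + j})_{1 <= i,j <= p_1}, with u_x(e_k) = lam^k x. *)
Definition schur (R : comNzRingType) (lam : nat -> R -> R) (p : seq nat) (x : R) : R :=
  let m := head 0%N p in
  \det (\matrix_(i < m, j < m)
          match ((conjp p i.+1)%:Z + j%:Z - i%:Z)%R with
          | Posz k => lam k x
          | Negz _ => 0
          end).

Definition schur_finite_bound (R : comNzRingType) (lam : nat -> R -> R)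
    (x : R) (mu : seq nat) : Prop :=
  forall p, is_partition p -> contains p mu -> schur lam p x = 0.

(* Main.v *)
Require Import Defs.
From HB Require Import structures.
From mathcomp Require Import all_boot all_order all_algebra.
From mathcomp Require Import fingroup perm qpoly mpoly boolp.
Import GRing.Theory.
Local Open Scope ring_scope.

(* The extension is the lambda-ring W(A) = 1 + t A[[t]] of power series over a
   ring A (addition is multiplication of series), for a suitable A containing R:
   y |-> 1 + y t + lam_2(y) t^2 + ... is an injective lambda-ring morphism from
   R to W(R), which is a lambda-subring of W(A), and the linear polynomials
   1 + a t are line elements.  The shapes (2, 1^(n-1)) give
   lam_(n+1)(x) = x lam_n(x) for n >= 2, so the series of x, multiplied by
   1 - x t, is the quadratic polynomial 1 + (lam_2(x) - x^2) t^2.  If that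
   polynomial splits over A as (1 + a t)(1 + b t), then
   x = [a] + [b] - [-x] in W(A).

   That W(A) is a lambda-ring is checked on finite products of linear factors,
   where the operations come from operations on multisets of roots; over an
   extension of A every series is such a product up to any prescribed order. *)

Set Implicit Arguments.
Unset Strict Implicit.
Unset Printing Implicit Defensive.

(* ssrfun's [esym] shadows the elementary symmetric function of Defs. *)
Local Notation elem := Defs.esym.

(** * Elementary symmetric functions *)

Definition epoly (S : comNzRingType) (s : seq S) : {poly S} :=
  \prod_(a <- s) (1 + a *: 'X).

Section ElementarySymmetric.
Variable S : comNzRingType.
Implicit Types (s t : seq S) (a c : S).

Lemma epoly_cat s t : epoly (s ++ t) = epoly s * epoly t.
Proof. exact: big_cat. Qed.

Lemma epoly_perm s t : perm_eq s t -> epoly s = epoly t.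
Proof. exact: perm_big. Qed.

Lemma elem_epoly s t k : epoly s = epoly t -> elem k s = elem k t.
Proof. by rewrite /epoly /elem => ->. Qed.

Lemma elem0 s : elem 0 s = 1.
Proof.
rewrite /elem; elim: s => [|a s IH]; first by rewrite big_nil coef1.
by rewrite big_cons coef0M IH coefD coef1 coefZ coefX mulr0 addr0 mulr1.
Qed.

Lemma elem_nil k : elem k ([::] : seq S) = (k == 0%N)%:R.
Proof. by rewrite /elem big_nil coef1. Qed.

Lemma elem_cons k a s : elem k.+1 (a :: s) = elem k.+1 s + a * elem k s.
Proof.
by rewrite /elem big_cons mulrDl mul1r coefD -scalerAl coefZ coefXM.
Qed.

Lemma elem_cat k s t :
  elem k (s ++ t) = \sum_(i < k.+1) elem i s * elem (k - i)%N t.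
Proof. by rewrite /elem big_cat coefM. Qed.

Lemma elem_oversize k s : (size s < k)%N -> elem k s = 0.
Proof.
elim: s k => [|a s IH] [|k] //= lt_sk; first by rewrite elem_nil.
by rewrite elem_cons !IH ?mulr0 ?addr0 // ltnW.
Qed.

Lemma elem1 s : elem 1 s = \sum_(a <- s) a.
Proof.
elim: s => [|a s IH]; first by rewrite elem_nil big_nil.
by rewrite elem_cons elem0 IH big_cons mulr1 addrC.
Qed.

Lemma elem_scale k c s : elem k [seq c * a | a <- s] = c ^+ k * elem k s.
Proof.
elim: s k => [|a s IH] [|k] /=; rewrite ?elem0 ?elem_nil ?mulr0 ?expr0 ?mulr1 //.
by rewrite !elem_cons !IH mulrDr exprS; congr (_ + _); rewrite -!mulrA;
   congr (_ * _); rewrite mulrCA.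
Qed.

Lemma elem_scale0_cat k s t : elem k ([seq 0 * a | a <- s] ++ t) = elem k t.
Proof.
elim: s k => [|a s IH] [|k] //=; rewrite ?elem0 //.
by rewrite elem_cons mul0r mul0r addr0 IH.
Qed.

Lemma sprods0 s : sprods 0 s = [:: 1].
Proof. by case: s. Qed.

Lemma sprods1 s : sprods 1 s = s.
Proof. by elim: s => //= a s ->; rewrite sprods0 /= mulr1. Qed.

Lemma sprods_scale n c s :
  sprods n [seq c * a | a <- s] = [seq c ^+ n * p | p <- sprods n s].
Proof.
elim: s n => [|a s IH] [|n] //=; rewrite ?mulr1 //.
rewrite !IH map_cat -!map_comp; congr (_ ++ _); apply: eq_map => p /=.
by rewrite exprS -!mulrA; congr (_ * _); rewrite mulrCA.
Qed.

Lemma elem_sprods n s : elem n s = \sum_(p <- sprods n s) p.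
Proof.
elim: s n => [|a s IH] [|n]; rewrite ?elem0 ?elem_nil ?big_seq1 //= ?big_nil //.
by rewrite elem_cons !IH big_cat big_map /= -mulr_sumr addrC.
Qed.

Lemma perm_sprods_swap n a b s :
  perm_eq (sprods n (a :: b :: s)) (sprods n (b :: a :: s)).
Proof.
case: n => [|[|n]] //=.
  by rewrite !sprods0 /= perm_sym (perm_catCA [:: _] [:: _]).
rewrite !map_cat -!catA.
have -> : [seq (b * p) | p <- [seq a * p | p <- sprods n s]] =
          [seq (a * p) | p <- [seq b * p | p <- sprods n s]].
  by rewrite -!map_comp; apply: eq_map => p /=; rewrite mulrCA.
by rewrite perm_cat2l !catA perm_cat2r perm_catC.
Qed.

Lemma perm_sprods_cons n a s t :
  (forall m, perm_eq (sprods m s) (sprods m t)) ->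
  perm_eq (sprods n (a :: s)) (sprods n (a :: t)).
Proof. by case: n => //= n st; apply: perm_cat => //; apply: perm_map. Qed.

(** Since [sprods] recurses on the head, an entry is carried inwards by adjacent swaps. The
    invariance is what makes [F] symmetric in [comp_univ_size]. *)
Lemma perm_sprods n s t : perm_eq s t -> perm_eq (sprods n s) (sprods n t).
Proof.
have mid a p q m : perm_eq (sprods m (a :: p ++ q)) (sprods m (p ++ a :: q)).
  elim: p m => [|b p IH] m //; rewrite !cat_cons.
  apply: perm_trans (perm_sprods_swap _ _ _ _) _.
  exact: perm_sprods_cons.
elim: s t n => [|a s IH] t n st.
  by move: (perm_size st) => /esym/size0nil ->.
have a_t : a \in t by rewrite -(perm_mem st) mem_head.
case/splitPr: t / a_t st => p q.
rewrite perm_sym -[a :: q]cat1s perm_catCA perm_cons perm_sym => spq.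
apply: perm_trans (mid _ _ _ _); apply: perm_sprods_cons => m; exact: IH.
Qed.

(** A product of two entries of [s ++ t] takes both from [s], both from [t], or one from each. *)
Lemma epoly_sprods2_cat s t : epoly (sprods 2 (s ++ t)) =
  epoly (sprods 2 s) * epoly (sprods 2 t) * epoly [seq u * v | u <- s, v <- t].
Proof.
elim: s => [|a s IH]; first by rewrite /= /epoly !big_nil mul1r mulr1.
rewrite /= !sprods1 map_cat !epoly_cat IH.
set x := epoly _; set y := epoly _; set z := epoly _; set w := epoly _.
by rewrite -!mulrA; congr (_ * _); rewrite [y * _]mulrCA; congr (_ * _);
   rewrite mulrCA.
Qed.

End ElementarySymmetric.

Section Naturality.
Variables (S T : comNzRingType) (f : {rmorphism S -> T}).
Implicit Types s : seq S.

Lemma elem_map k s : elem k (map f s) = f (elem k s).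
Proof.
elim: s k => [|a s IH] [|k] /=; rewrite ?elem0 ?elem_nil ?rmorph1 ?rmorph0 //.
by rewrite !elem_cons !IH rmorphD rmorphM.
Qed.

Lemma sprods_map n s : sprods n (map f s) = map f (sprods n s).
Proof.
elim: s n => [|a s IH] [|n] //=; rewrite ?rmorph1 //.
rewrite !IH map_cat -!map_comp; congr (_ ++ _); apply: eq_map => p /=.
by rewrite rmorphM.
Qed.

Lemma leval_map (fx fy : nat -> S) (Q : lterm) :
  f (leval fx fy Q) = leval (f \o fx) (f \o fy) Q.
Proof.
elim: Q => //= [z|P IHP Q IHQ|P IHP Q IHQ].
- by rewrite rmorph_int.
- by rewrite rmorphD IHP IHQ.
- by rewrite rmorphM IHP IHQ.
Qed.

End Naturality.

(** * Splitting truncated series into linear factors over an extension *)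

Section Splitting.
Import Pdiv.CommonRing Pdiv.RingMonic.

(** The extension is A[X]/(p), with the class of X as root. Constants stay distinct in it because
    [p] is monic of positive degree. *)
Lemma adjoin_root (A : comNzRingType) (p : {poly A}) :
  p \is monic -> (1 < size p)%N ->
  exists (B : comNzRingType) (f : {rmorphism A -> B}),
    injective f /\ exists r, root (map_poly f p) r.
Proof.
move=> mon_p sz_p.
(* The quotient is taken modulo [mk_monic p], which has to be identified with [p] first. *)
have mkp : mk_monic p = p by rewrite /mk_monic sz_p mon_p.
exists {poly %/ p}, (qpolyC p); split.
  by move=> a b /(congr1 val) /= /polyC_inj.
exists (in_qpoly p 'X); rewrite /root horner_poly.
have -> : \sum_(i < size p) qpolyC p p`_i * in_qpoly p 'X ^+ i = in_qpoly p p.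
  rewrite -[X in _ = in_qpoly p X]coefK poly_def raddf_sum; apply: eq_bigr => i _.
  rewrite -mul_polyC /= in_qpolyM rmorphXn; congr (_ * _).
  apply: val_inj; rewrite /= mkp rmodp_small //.
  exact: leq_ltn_trans (size_polyC_leq1 _) sz_p.
apply/eqP/val_inj => /=; rewrite mkp.
exact: rmodpp.
Qed.

(** Roots are adjoined one at a time, the remaining cofactor staying monic. Factors are written
    ['X + a], so that Vieta's formulas carry no signs. *)
Lemma monic_splits (n : nat) (A : comNzRingType) (p : {poly A}) :
  p \is monic -> size p = n.+1 ->
  exists (B : comNzRingType) (f : {rmorphism A -> B}),
    injective f /\ exists2 s : seq B, size s = n &
      map_poly f p = \prod_(a <- s) ('X + a%:P).
Proof.
elim: n A p => [|n IH] A p mon_p sz_p.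
  exists A, idfun; split=> //; exists [::] => //.
  rewrite map_poly_id // big_nil; apply/polyP => i.
  have /size_poly1P [c _ pE] : size p == 1%N by rewrite sz_p.
  by move: mon_p; rewrite pE monicE lead_coefC => /eqP ->.
have [|B [f [inj_f [r rt]]]] := adjoin_root mon_p; first by rewrite sz_p.
have mon_fp : map_poly f p \is monic by apply: monic_map.
have [q fpE] := factor_theorem _ _ rt.
have mon_q : q \is monic.
  by move: mon_fp; rewrite fpE monicMr // monicXsubC.
have sz_q : size q = n.+1.
  have : size (map_poly f p) = n.+2.
    rewrite size_map_poly_id0 // (eqP mon_p) rmorph1; exact: oner_neq0.
  rewrite fpE size_Mmonic ?monicXsubC ?monic_neq0 // size_XsubC.
  by rewrite addn2 /= => -[].
have [C [g [inj_g [s sz_s qE]]]] := IH B q mon_q sz_q.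
exists C, (g \o f); split; first exact: inj_comp.
exists (- g r :: s); first by rewrite /= sz_s.
rewrite map_poly_comp /= fpE rmorphM /= qE big_cons mulrC; congr (_ * _).
by rewrite rmorphB /= map_polyX map_polyC rmorphN.
Qed.

Lemma coef_prod_XaddC (A : comNzRingType) (s : seq A) k :
  (k <= size s)%N -> (\prod_(a <- s) ('X + a%:P))`_(size s - k) = elem k s.
Proof.
have sz (t : seq A) : size (\prod_(a <- t) ('X + a%:P)) = (size t).+1.
  rewrite -(size_prod_XsubC t -%R); congr (size (polyseq _)).
  by apply: eq_bigr => a _; rewrite rmorphN opprK.
elim: s k => [|a s IH] [|k] //= le_ks.
- by rewrite big_nil coef1 elem0.
- rewrite elem0 subn0 big_cons mulrDl coefD coefXM coefCM /=.
  rewrite [X in a * X]nth_default ?sz // mulr0 addr0 -[size s]subn0 IH //.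
  by rewrite elem0.
rewrite subSS elem_cons big_cons mulrDl coefD coefCM IH // coefXM.
(* At the boundary [k = size s] the shifted product has constant coefficient 0, matching the
   vanishing of [elem k.+1 s]. *)
move: le_ks; rewrite ltnS leq_eqVlt => /predU1P[->|lt_ks].
  by rewrite subnn eqxx [elem _.+1 s]elem_oversize.
by rewrite subn_eq0 leqNgt lt_ks /= -subnS IH.
Qed.

(** The truncation at order [n], read backwards, is monic of degree [n] because [c 0 = 1]; Vieta's
    formulas recover the coefficients from its factors. *)
Lemma series_splits (A : comNzRingType) (c : nat -> A) n : c 0%N = 1 ->
  exists (B : comNzRingType) (f : {rmorphism A -> B}),
    injective f /\ exists2 s : seq B, size s = n &
      forall k, (k <= n)%N -> elem k s = f (c k).
Proof.
move=> c0; pose p := \poly_(i < n.+1) c (n - i)%N.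
have sz_p : size p = n.+1 by rewrite size_poly_eq // subnn c0 oner_neq0.
have mon_p : p \is monic.
  by rewrite monicE lead_coefE sz_p coef_poly ltnSn subnn c0.
have [B [f [inj_f [s sz_s pE]]]] := monic_splits mon_p sz_p.
exists B, f; split=> //; exists s => // k le_kn.
rewrite -coef_prod_XaddC ?sz_s // -pE coef_map coef_poly.
by rewrite ltnS leq_subr subKn.
Qed.

End Splitting.

(** * Existence of the universal polynomials *)

Definition lsum (I : Type) (r : seq I) (F : I -> lterm) : lterm :=
  foldr (fun i => TAdd (F i)) (TC 0) r.

Definition lprod (I : Type) (r : seq I) (F : I -> lterm) : lterm :=
  foldr (fun i => TMul (F i)) (TC 1) r.

Definition lexp (Q : lterm) (n : nat) : lterm := iter n (TMul Q) (TC 1).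

Fixpoint lsubst (sx sy : nat -> lterm) (Q : lterm) : lterm :=
  match Q with
  | TX k => sx k
  | TY k => sy k
  | TC z => TC z
  | TAdd P Q => TAdd (lsubst sx sy P) (lsubst sx sy Q)
  | TMul P Q => TMul (lsubst sx sy P) (lsubst sx sy Q)
  end.

(** Index [i] becomes [TX i.+1] because variable number 0 stands for the first elementary symmetric
    function. *)
Definition lmpoly (n : nat) (p : {mpoly int[n]}) : lterm :=
  lsum (msupp p) (fun m =>
    TMul (TC p@_m) (lprod (index_enum 'I_n) (fun i => lexp (TX i.+1) (m i)))).

Definition lconv (k : nat) : lterm :=
  lsum (index_enum 'I_k.+1) (fun i => TMul (TX i) (TY (k - i))).

Section LTermEval.
Variables (S : comNzRingType) (fx fy : nat -> S).

Lemma leval_sum (I : Type) (r : seq I) (F : I -> lterm) :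
  leval fx fy (lsum r F) = \sum_(i <- r) leval fx fy (F i).
Proof. by elim: r => [|i r IH]; rewrite ?big_nil // big_cons -IH. Qed.

Lemma leval_prod (I : Type) (r : seq I) (F : I -> lterm) :
  leval fx fy (lprod r F) = \prod_(i <- r) leval fx fy (F i).
Proof. by elim: r => [|i r IH]; rewrite ?big_nil // big_cons -IH. Qed.

Lemma leval_exp (Q : lterm) n : leval fx fy (lexp Q n) = leval fx fy Q ^+ n.
Proof. by elim: n => //= n IH; rewrite exprS -IH. Qed.

Lemma leval_subst (sx sy : nat -> lterm) (Q : lterm) :
  leval fx fy (lsubst sx sy Q) =
  leval (fun k => leval fx fy (sx k)) (fun k => leval fx fy (sy k)) Q.
Proof. by elim: Q => //= P -> Q ->. Qed.

Lemma leval_conv k :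
  leval fx fy (lconv k) = \sum_(i < k.+1) fx i * fy (k - i)%N.
Proof. exact: leval_sum. Qed.

Lemma leval_mpoly (n : nat) (p : {mpoly int[n]}) :
  leval fx fy (lmpoly p) = mmap intr (fun i : 'I_n => fx i.+1) p.
Proof.
rewrite leval_sum; apply: eq_bigr => m _ /=; congr (_ * _).
by rewrite leval_prod; apply: eq_bigr => i _; rewrite leval_exp.
Qed.

Lemma eq_leval (gx gy : nat -> S) (Q : lterm) :
  fx =1 gx -> fy =1 gy -> leval fx fy Q = leval gx gy Q.
Proof. by move=> ex ey; elim: Q => //= P -> Q ->. Qed.

End LTermEval.

(** Polynomial expressions respect congruence modulo ['X^d.+1]. *)
Lemma leval_coef_congr (S : comNzRingType) (fx fy gx gy : nat -> {poly S}) d Q :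
  (forall k i, (i <= d)%N -> (fx k)`_i = (gx k)`_i) ->
  (forall k i, (i <= d)%N -> (fy k)`_i = (gy k)`_i) ->
  forall i, (i <= d)%N -> (leval fx fy Q)`_i = (leval gx gy Q)`_i.
Proof.
move=> ex ey; elim: Q => //= [P IHP Q IHQ|P IHP Q IHQ] i le_id.
  by rewrite !coefD IHP ?IHQ.
rewrite !coefM; apply: eq_bigr => j _; congr (_ * _).
  by apply: IHP; rewrite (leq_trans _ le_id) // -ltnS.
by apply: IHQ; rewrite (leq_trans (leq_subr _ _)).
Qed.

Lemma elem_ffun (S : comNzRingType) (s : seq S) k :
  elem k s =
  \sum_(h : {set 'I_(size s)} | #|h| == k) \prod_(i in h) s`_i.
Proof.
rewrite /elem (big_nth 0) big_mkord.
rewrite (eq_bigr (fun i : 'I__ => s`_i *: 'X + 1)); last first.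
  by move=> i _; rewrite addrC.
rewrite bigA_distr coef_sum [RHS]big_mkcond; apply: eq_bigr => h _.
rewrite -big_mkcond scaler_prod prodr_const coefZ coefXn eq_sym.
by case: eqP; rewrite ?mulr1 ?mulr0.
Qed.

(** For a fixed length this is the fundamental theorem on symmetric polynomials, applied to [L]
    indeterminates over the integers; every list of length [L] is a specialisation of them. *)
Lemma comp_univ_size m n L : exists Q : lterm,
  forall (S : comNzRingType) (s : seq S), size s = L ->
    elem m (sprods n s) = leval (fun k => elem k s) (fun _ => 0) Q.
Proof.
pose X := [seq ('X_i : {mpoly int[L]}) | i <- enum 'I_L].
pose F := elem m (sprods n X).
have symF : F \is symmetric.
  apply/issymP => s; rewrite -elem_map -sprods_map.
  apply: elem_epoly; apply: epoly_perm; apply: perm_sprods.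
  have -> : map (msym s) X = [seq 'X_i | i <- map s (enum 'I_L)].
    rewrite -!map_comp; apply: eq_map => i /=.
    by rewrite /msym mmapX mmap1U.
  apply: perm_map; apply: uniq_perm.
  - by rewrite map_inj_uniq ?enum_uniq //; exact: perm_inj.
  - exact: enum_uniq.
  move=> i; rewrite mem_enum inE; apply/mapP; exists (s^-1 i)%g.
    by rewrite mem_enum.
  by rewrite permKV.
have FE := symfP symF; exists (lmpoly (symf F)) => S s sz_s.
rewrite leval_mpoly; pose ev : {rmorphism {mpoly int[L]} -> S} :=
  mmap intr (fun i : 'I_L => s`_i).
have evX : map ev X = s.
  rewrite /X -map_comp; apply: (@eq_from_nth _ 0).
    by rewrite size_map size_enum_ord.
  move=> i; rewrite size_map size_enum_ord => lt_iL.
  rewrite (nth_map (Ordinal lt_iL)) ?size_enum_ord // /ev /= mmapX mmap1U.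
  by rewrite nth_enum_ord.
have -> : elem m (sprods n s) = ev F by rewrite -elem_map -sprods_map evX.
move: (symf F) FE => q ->.
rewrite /comp_mpoly [X in ev X]/mmap rmorph_sum; apply: eq_bigr => k _.
rewrite rmorphM /=; congr (_ * _); first by rewrite /ev mmapC.
rewrite rmorph_prod; apply: eq_bigr => i _; rewrite rmorphXn /=; congr (_ ^+ _).
(* Both sides are now sums over the subsets of size [i.+1] of the index set. *)
rewrite tnth_mktuple elem_ffun rmorph_sum /=; subst L.
by apply: eq_bigr => h _; rewrite rmorph_prod; apply: eq_bigr => j _;
   rewrite /= /ev mmapX mmap1U.
Qed.

Lemma elem_pad0 (S : comNzRingType) (s : seq S) j k :
  elem k (nseq j 0 ++ s) = elem k s.
Proof.
elim: j k => //= j IH [|k]; first by rewrite !elem0.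
by rewrite elem_cons mul0r addr0 IH.
Qed.

Lemma elem_sprods_pad0 (S : comNzRingType) (s : seq S) j m n :
  elem m (sprods n (nseq j 0 ++ s)) = elem m (sprods n s).
Proof.
elim: j n => //= j IH [|n]; first by rewrite sprods0.
by rewrite /= elem_scale0_cat IH.
Qed.

(* Scaling the alphabet by 'X turns weight into 'X-degree, so the part of
   weight m * n is visible modulo 'X^(m * n).+1. *)
Lemma elem_sprods_stable (S : comNzRingType) (s t : seq S) m n :
  (forall k, (k <= n * m)%N -> elem k s = elem k t) ->
  elem m (sprods n s) = elem m (sprods n t).
Proof.
move=> eq_st; pose L := maxn (size s) (size t).
have [Q QP] := comp_univ_size m n L.
(* Leading zeros leave the elementary symmetric functions unchanged and bring both lists to length
   [L], so that the same [Q] applies to them. *)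
pose pad u := [seq 'X * a | a <- map (@polyC S) (nseq (L - size u) 0 ++ u)].
have sz_pad u : (size u <= L)%N -> size (pad u) = L.
  by move=> le_uL; rewrite !size_map size_cat size_nseq subnK.
have elem_pad u k : elem k (pad u) = 'X^k * (elem k u)%:P.
  by rewrite elem_scale elem_map elem_pad0.
have padE u : (elem m (sprods n (pad u)))`_(n * m) = elem m (sprods n u).
  rewrite sprods_scale elem_scale sprods_map elem_map elem_sprods_pad0.
  by rewrite -exprM coefXnM ltnn subnn coefC.
rewrite -[LHS]padE -[RHS]padE !QP ?sz_pad ?leq_maxl ?leq_maxr //.
apply: (leval_coef_congr (d := n * m)) => // k i le_id.
rewrite !elem_pad !coefXnM; case: ltnP => // le_ki.
by rewrite !coefC; case: eqP => // eq_ik; rewrite eq_st // (leq_trans le_ki).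
Qed.

(** The polynomial for length [n * m] serves all lengths: by stability [s] may be replaced by a list
    of that length, over an extension, with the same elementary symmetric functions up to [n * m].
    The substitution [cut] sets the higher ones to 0, as they are for the short list. *)
Lemma comp_univ_exists m n : exists Q, comp_univ m n Q.
Proof.
have [Q QP] := comp_univ_size m n (n * m).
pose cut k := if (k <= n * m)%N then TX k else TC 0.
exists (lsubst cut TY Q) => S s.
have [T [f [inj_f [t sz_t tE]]]] := series_splits (n * m) (elem0 s).
apply: inj_f; rewrite -elem_map -sprods_map.
rewrite (@elem_sprods_stable _ _ t) => [|k le_k]; last by rewrite elem_map tE.
rewrite QP // leval_subst leval_map.
apply: eq_leval => k /=; last by rewrite rmorph0.
rewrite /cut; case: leqP => [/tE -> //|lt_k].
by rewrite elem_oversize ?sz_t // rmorph0.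
Qed.

(* The product is the cross term of the second exterior power:
   lambda^2 (x + y) = lambda^2 x + x y + lambda^2 y. *)
Lemma mul_univ_exists n : exists Q, mul_univ n Q.
Proof.
have [c2 c2P] := choice (fun m => comp_univ_exists m 2).
pose U k := lsubst lconv (fun=> TC 0) (c2 k).
pose V k := lsum (index_enum 'I_k.+1) (fun i =>
  TMul (lsubst TX (fun=> TC 0) (c2 i)) (lsubst TY (fun=> TC 0) (c2 (k - i)%N))).
have UP (S : comNzRingType) (s t : seq S) k : elem k (sprods 2 (s ++ t)) =
    leval (fun k => elem k s) (fun k => elem k t) (U k).
  rewrite c2P leval_subst; apply: eq_leval => j //=.
  by rewrite elem_cat leval_conv.
have VP (S : comNzRingType) (s t : seq S) k :
    elem k (sprods 2 s ++ sprods 2 t) =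
    leval (fun k => elem k s) (fun k => elem k t) (V k).
  rewrite elem_cat leval_sum; apply: eq_bigr => i _ /=.
  by rewrite !leval_subst !c2P.
suff [M MP] : exists M, forall k, (k < n.+1)%N -> mul_univ k (M k).
  by exists (M n); apply: MP.
elim: {n}(n.+1) => [|n [M MP]]; first by exists TX.
(* Solves the coefficient of degree [n] in [epoly_sprods2_cat] for the cross term: its factor is
   [elem 0 = 1], and the other summands involve only smaller indices of [M]. *)
pose N := TAdd (U n) (TMul (TC (-1)) (lsum (index_enum 'I_n) (fun i =>
  TMul (V i.+1) (M (n - i.+1)%N)))).
exists (fun k => if (k < n)%N then M k else N) => k lt_kn.
case: ltnP => [|le_nk]; first exact: MP.
have {k lt_kn le_nk} -> : k = n by apply/eqP; rewrite eqn_leq le_nk andbT -ltnS.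
move=> S s t /=; rewrite -UP leval_sum.
have -> : elem n (sprods 2 (s ++ t)) = \sum_(i < n.+1)
    elem i (sprods 2 s ++ sprods 2 t) *
    elem (n - i)%N [seq u * v | u <- s, v <- t].
  by rewrite -elem_cat; apply: elem_epoly; rewrite !epoly_cat epoly_sprods2_cat.
rewrite big_ord_recl elem0 mul1r subn0 mulN1r.
rewrite [X in _ + X - _](_ : _ = \sum_(i < n)
    leval (fun k => elem k s) (fun k => elem k t)
      (TMul (V i.+1) (M (n - i.+1)%N))) ?addrK //.
apply: eq_bigr => i _ /=; rewrite VP MP //.
by rewrite ltn_subrL (leq_trans _ (ltn_ord i)).
Qed.

(** * The ring of power series with constant term 1 *)

(* [Witt c] is the power series 1 + c_0 t + c_1 t^2 + ... *)
Record witt (A : comNzRingType) : Type := Witt { wtail : nat -> A }.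

HB.instance Definition _ (A : comNzRingType) := gen_eqMixin (witt A).
HB.instance Definition _ (A : comNzRingType) := gen_choiceMixin (witt A).

Definition wcoef (A : comNzRingType) (u : witt A) (k : nat) : A :=
  if k is j.+1 then wtail u j else 1.

(** The value [c 0] is discarded, the constant term being 1 by construction. *)
Definition wseries (A : comNzRingType) (c : nat -> A) : witt A :=
  Witt (fun k => c k.+1).

Definition wmap (A B : comNzRingType) (f : A -> B) (u : witt A) : witt B :=
  wseries (fun k => f (wcoef u k)).

Definition wop (P : nat -> lterm) (A : comNzRingType) (u v : witt A) : witt A :=
  wseries (fun k => leval (wcoef u) (wcoef v) (P k)).

Definition wconst (c : nat -> int) (A : comNzRingType) : witt A :=
  wseries (fun k => (c k)%:~R).

Definition weff (A : comNzRingType) (s : seq A) : witt A :=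
  wseries (fun k => elem k s).

Arguments wseries : simpl never.
Arguments wcoef : simpl nomatch.

Lemma witt_ext (A : comNzRingType) (u v : witt A) :
  wcoef u =1 wcoef v -> u = v.
Proof.
case: u v => u [v] uv; congr Witt; apply: funext => k; exact: (uv k.+1).
Qed.

Lemma wcoef_series (A : comNzRingType) (c : nat -> A) :
  c 0%N = 1 -> wcoef (wseries c) =1 c.
Proof. by move=> c0 [|k]. Qed.

Lemma wcoef_eff (A : comNzRingType) (s : seq A) k : wcoef (weff s) k = elem k s.
Proof. by rewrite wcoef_series ?elem0. Qed.

Lemma wcoef_map (A B : comNzRingType) (f : {rmorphism A -> B}) (u : witt A) k :
  wcoef (wmap f u) k = f (wcoef u k).
Proof. by rewrite wcoef_series ?rmorph1. Qed.

Lemma wmap_inj (A B : comNzRingType) (f : {rmorphism A -> B}) :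
  injective f -> injective (wmap f).
Proof.
by move=> inj_f u v uv; apply: witt_ext => k; apply: inj_f; rewrite -!wcoef_map uv.
Qed.

Lemma weff_epoly (A : comNzRingType) (s t : seq A) :
  epoly s = epoly t -> weff s = weff t.
Proof. by move=> st; apply: witt_ext => k; rewrite !wcoef_eff; apply: elem_epoly. Qed.

Lemma wmap_eff (A B : comNzRingType) (f : {rmorphism A -> B}) (s : seq A) :
  wmap f (weff s) = weff (map f s).
Proof. by apply: witt_ext => k; rewrite wcoef_map !wcoef_eff elem_map. Qed.

(** * Natural continuous operations and the splitting principle *)

Definition wagree (N : nat) (A : comNzRingType) (u v : witt A) : Prop :=
  forall k, (k <= N)%N -> wcoef u k = wcoef v k.

Definition witt_op := forall A : comNzRingType, (nat -> witt A) -> witt A.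

(** Naturality in the ring allows passing to an extension; t-adic continuity, with a modulus [N]
    uniform in [A], allows truncating. The family [w] holds the arguments of an operation of any
    arity. *)
Definition natcont (F : witt_op) : Prop :=
  (forall (A B : comNzRingType) (f : {rmorphism A -> B}) (w : nat -> witt A),
     F B (fun i => wmap f (w i)) = wmap f (F A w)) /\
  (forall M, exists N, forall (A : comNzRingType) (w w' : nat -> witt A),
     (forall i, wagree N (w i) (w' i)) -> wagree M (F A w) (F A w')).

Lemma natcont_ext (F G : witt_op) :
  (forall A w, F A w = G A w) -> natcont F -> natcont G.
Proof.
move=> FG [natF contF]; split=> [A B f w|M]; first by rewrite -!FG.
by have [N NP] := contF M; exists N => A w w' /NP; rewrite -!FG.
Qed.

Lemma natcont_var i : natcont (fun A w => w i).
Proof. by split=> // M; exists M => A w w'; apply. Qed.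

Lemma natcont_const c : natcont (fun A w => wconst c A).
Proof.
split=> [A B f w|M]; last by exists 0%N.
by apply: witt_ext => -[|k] //=; rewrite rmorph_int.
Qed.

Fixpoint lbound (Q : lterm) : nat :=
  match Q with
  | TX k | TY k => k
  | TC _ => 0
  | TAdd P Q | TMul P Q => maxn (lbound P) (lbound Q)
  end.

Lemma eq_leval_bound (S : comNzRingType) (fx fy gx gy : nat -> S) (Q : lterm) :
  (forall k, (k <= lbound Q)%N -> fx k = gx k) ->
  (forall k, (k <= lbound Q)%N -> fy k = gy k) ->
  leval fx fy Q = leval gx gy Q.
Proof.
elim: Q => /= [k ex _|k _ ey||P IHP Q IHQ ex ey|P IHP Q IHQ ex ey] //;
  rewrite ?ex ?ey // IHP ?IHQ // => k le_k; rewrite ?ex ?ey //;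
  by rewrite leq_max le_k ?orbT.
Qed.

Lemma natcont_op P (F G : witt_op) :
  natcont F -> natcont G -> natcont (fun A w => wop P (F A w) (G A w)).
Proof.
move=> [natF contF] [natG contG]; split=> [A B f w|M].
  apply: witt_ext => -[|k] //=; rewrite natF natG leval_map.
  by apply: eq_leval => j; rewrite wcoef_map.
pose K := \max_(k < M.+1) lbound (P k).
have [[N1 FP] [N2 GP]] := (contF K, contG K).
exists (maxn N1 N2) => A w w' ww' [|k] //= lt_kM.
have ww1 i : wagree N1 (w i) (w' i).
  by move=> j le_j; apply: ww'; rewrite leq_max le_j.
have ww2 i : wagree N2 (w i) (w' i).
  by move=> j le_j; apply: ww'; rewrite leq_max le_j orbT.
have leK : (lbound (P k.+1) <= K)%N.
  exact: (leq_bigmax (F := fun k : 'I_M.+1 => lbound (P k))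
    (Ordinal (lt_kM : (k.+1 < M.+1)%N))).
by apply: eq_leval_bound => j le_j; [apply: FP|apply: GP] => //;
   apply: leq_trans leK.
Qed.

(** The series are split one after another, each over an extension of the ring that splits the
    previous ones. *)
Lemma witt_splits (A : comNzRingType) (us : seq (witt A)) N :
  exists (B : comNzRingType) (f : {rmorphism A -> B}), injective f /\
    exists ss : seq (seq B), forall i,
      wagree N (wmap f (nth (weff [::]) us i)) (weff (nth [::] ss i)).
Proof.
move: {-1}(size us) (erefl (size us)) => n; elim: n A us => [|n IH] A [|u us] //=.
  move=> _; exists A, idfun; split=> //; exists [::] => i k _.
  by rewrite !nth_nil wmap_eff.
case=> sz_us.
have [B [f [inj_f [s _ sP]]]] := series_splits N (erefl : wcoef u 0 = 1).
have [|C [g [inj_g [ss ssP]]]] := IH B (map (wmap f) us); first by rewrite size_map.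
exists C, (g \o f); split; first exact: inj_comp.
exists (map g s :: ss) => -[|i] k le_kN /=.
  by rewrite wcoef_map wcoef_eff elem_map sP.
have -> : wmap (g \o f) (nth (weff [::]) us i) =
    wmap g (nth (weff [::]) (map (wmap f) us) i).
  case: (ltnP i (size us)) => [lt_i|le_i].
    by rewrite (nth_map (weff [::])).
  by rewrite !nth_default ?size_map // !wmap_eff.
exact: ssP.
Qed.

(* Up to any given order, every series splits over an extension. *)
Lemma natcont_eq (F G : witt_op) : natcont F -> natcont G ->
  (forall (A : comNzRingType) (ss : nat -> seq A),
     F A (fun i => weff (ss i)) = G A (fun i => weff (ss i))) ->
  forall (A : comNzRingType) (us : seq (witt A)),
    F A (nth (weff [::]) us) = G A (nth (weff [::]) us).
Proof.
move=> [natF contF] [natG contG] FG A us; apply: witt_ext => k.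
have [[N1 FP] [N2 GP]] := (contF k, contG k).
have [B [f [inj_f [ss ssP]]]] := witt_splits us (maxn N1 N2).
(* Naturality moves the coefficient identity into [B]; continuity then replaces the arguments by
   split series. *)
apply: inj_f; rewrite -!wcoef_map -natF -natG.
rewrite (FP _ _ (fun i => weff (nth [::] ss i))) //; last first.
  by move=> i j le_j; apply: ssP; rewrite leq_max le_j.
rewrite (GP _ _ (fun i => weff (nth [::] ss i))) ?FG //.
by move=> i j le_j; apply: ssP; rewrite leq_max le_j orbT.
Qed.

(** * Ring and lambda operations on series *)

Definition mul_term (n : nat) : lterm := sval (cid (mul_univ_exists n)).

Definition comp_term (m n : nat) : lterm := sval (cid (comp_univ_exists m n)).

Definition wadd := wop lconv.

Definition wmul := wop mul_term.

Definition wlam (A : comNzRingType) (n : nat) (u : witt A) : witt A :=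
  wop (fun m => lsubst TX (fun=> TC 0) (comp_term m n)) u u.

Definition wzero := wconst (fun k => (k == 0%N)%:R).

Definition wone := wconst (fun k => (k <= 1)%N%:R).

(* 1 / (1 + t), the additive inverse of the unit series 1 + t *)
Definition wneg1 := wconst (fun k => (-1) ^+ k).

Section EffectiveSeries.
Variable A : comNzRingType.
Implicit Types s t : seq A.

Lemma wzero_eff : wzero A = weff [::].
Proof. by apply: witt_ext => -[|k] //=; rewrite elem_nil. Qed.

Lemma wone_eff : wone A = weff [:: 1].
Proof.
apply: witt_ext => -[|[|k]] //=; rewrite elem_cons !elem_nil //= ?mul1r.
  by rewrite add0r.
by rewrite addr0.
Qed.

Lemma wadd_eff s t : wadd (weff s) (weff t) = weff (s ++ t).
Proof.
apply: witt_ext => -[|k] //=; rewrite leval_conv elem_cat.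
by apply: eq_bigr => i _; rewrite !wcoef_eff.
Qed.

Lemma wmul_eff s t :
  wmul (weff s) (weff t) = weff [seq u * v | u <- s, v <- t].
Proof.
apply: witt_ext => -[|k] //=; rewrite /mul_term; case: cid => Q /= ->.
by apply: eq_leval => j; rewrite wcoef_eff.
Qed.

Lemma wlam_eff n s : wlam n (weff s) = weff (sprods n s).
Proof.
apply: witt_ext => -[|k] //=; rewrite /comp_term; case: cid => Q /= ->.
by rewrite leval_subst; apply: eq_leval => j //=; rewrite wcoef_eff.
Qed.

End EffectiveSeries.

Section WittRing.
Variable A : comNzRingType.

Fact waddA : associative (@wadd A).
Proof.
move=> u v w.
apply: (@natcont_eq (fun A w => wadd (w 0%N) (wadd (w 1%N) (w 2%N)))
  (fun A w => wadd (wadd (w 0%N) (w 1%N)) (w 2%N)) _ _ _ _ [:: u; v; w]).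
- by do ?apply: natcont_op; apply: natcont_var.
- by do ?apply: natcont_op; apply: natcont_var.
by move=> B ss; rewrite !wadd_eff catA.
Qed.

Fact waddC : commutative (@wadd A).
Proof.
move=> u v.
apply: (@natcont_eq (fun A w => wadd (w 0%N) (w 1%N))
  (fun A w => wadd (w 1%N) (w 0%N)) _ _ _ _ [:: u; v]).
- by do ?apply: natcont_op; apply: natcont_var.
- by do ?apply: natcont_op; apply: natcont_var.
move=> B ss; rewrite !wadd_eff; apply: weff_epoly; apply: epoly_perm.
by rewrite perm_catC.
Qed.

Fact wadd0 : left_id (wzero A) (@wadd A).
Proof.
move=> u.
apply: (@natcont_eq (fun A w => wadd (wzero A) (w 0%N))
  (fun A w => w 0%N) _ _ _ _ [:: u]).
- by apply: natcont_op; [apply: natcont_const|apply: natcont_var].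
- exact: natcont_var.
by move=> B ss; rewrite wzero_eff wadd_eff.
Qed.

Fact wmulC : commutative (@wmul A).
Proof.
move=> u v.
apply: (@natcont_eq (fun A w => wmul (w 0%N) (w 1%N))
  (fun A w => wmul (w 1%N) (w 0%N)) _ _ _ _ [:: u; v]).
- by do ?apply: natcont_op; apply: natcont_var.
- by do ?apply: natcont_op; apply: natcont_var.
move=> B ss; rewrite !wmul_eff; apply: weff_epoly.
rewrite /epoly !big_allpairs_dep exchange_big /=.
by apply: eq_bigr => a _; apply: eq_bigr => b _; rewrite mulrC.
Qed.

Fact wmulA : associative (@wmul A).
Proof.
move=> u v w.
apply: (@natcont_eq (fun A w => wmul (w 0%N) (wmul (w 1%N) (w 2%N)))
  (fun A w => wmul (wmul (w 0%N) (w 1%N)) (w 2%N)) _ _ _ _ [:: u; v; w]).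
- by do ?apply: natcont_op; apply: natcont_var.
- by do ?apply: natcont_op; apply: natcont_var.
move=> B ss; rewrite !wmul_eff; apply: weff_epoly.
rewrite /epoly !big_allpairs_dep; apply: eq_bigr => a _.
rewrite big_allpairs_dep; apply: eq_bigr => b _.
by apply: eq_bigr => c _; rewrite mulrA.
Qed.

Fact wmul1 : left_id (wone A) (@wmul A).
Proof.
move=> u.
apply: (@natcont_eq (fun A w => wmul (wone A) (w 0%N))
  (fun A w => w 0%N) _ _ _ _ [:: u]).
- by apply: natcont_op; [apply: natcont_const|apply: natcont_var].
- exact: natcont_var.
move=> B ss; rewrite wone_eff wmul_eff /= cats0; congr weff.
by rewrite -[RHS]map_id; apply: eq_map => a; rewrite mul1r.
Qed.

Fact wmulDl : left_distributive (@wmul A) (@wadd A).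
Proof.
move=> u v w.
apply: (@natcont_eq (fun A w => wmul (wadd (w 0%N) (w 1%N)) (w 2%N))
  (fun A w => wadd (wmul (w 0%N) (w 2%N)) (wmul (w 1%N) (w 2%N)))
  _ _ _ _ [:: u; v; w]).
- by do ?apply: natcont_op; apply: natcont_var.
- by do ?apply: natcont_op; apply: natcont_var.
by move=> B ss; rewrite !(wmul_eff, wadd_eff) allpairs_cat.
Qed.

(** Obtained by splitting rather than from ring theory, since [waddN] relies on it before additive
    inverses are available. *)
Fact wmul0 u : wmul (wzero A) u = wzero A.
Proof.
apply: (@natcont_eq (fun A w => wmul (wzero A) (w 0%N))
  (fun A w => wzero A) _ _ _ _ [:: u]).
- by apply: natcont_op; [apply: natcont_const|apply: natcont_var].
- exact: natcont_const.
by move=> B ss; rewrite wzero_eff wmul_eff.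
Qed.

Fact waddN1 : wadd (wneg1 A) (wone A) = wzero A.
Proof.
have neg1E j : wcoef (wneg1 A) j = (-1) ^+ j.
  by case: j => [|j] //=; rewrite rmorphXn /= rmorphN1.
have oneE j : wcoef (wone A) j = (j <= 1)%N%:R by case: j => [|[|j]].
(* As 1 + t has only two nonzero coefficients, only the last two terms of the convolution survive,
   and they cancel. *)
apply: witt_ext => -[|k] //=; rewrite leval_conv 2!big_ord_recr /=.
rewrite big1 => [|i _]; last first.
  by rewrite oneE leqNgt ltn_subRL addn1 ltnS ltn_ord mulr0.
rewrite add0r !oneE !neg1E subnn subSnn !mulr1.
by rewrite rmorphXn /= rmorphN1 exprS mulN1r addrN.
Qed.

Fact waddN : left_inverse (wzero A) (wmul (wneg1 A)) (@wadd A).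
Proof.
by move=> u; rewrite -{2}[u]wmul1 -wmulDl waddN1 wmul0.
Qed.

Fact wone_neq0 : wone A != wzero A.
Proof.
apply/eqP => /(congr1 (fun u => wcoef u 1)) /= /eqP.
by rewrite rmorph1 rmorph0 (negPf (oner_neq0 A)).
Qed.

HB.instance Definition _ :=
  GRing.isZmodule.Build (witt A) waddA waddC wadd0 waddN.

HB.instance Definition _ := GRing.Zmodule_isComNzRing.Build (witt A)
  wmulA wmulC wmul1 wmulDl wone_neq0.

End WittRing.

(** * The lambda-structure *)

Definition teich (A : comNzRingType) (a : A) : witt A := weff [:: a].

Section Teichmuller.
Variable A : comNzRingType.
Implicit Types (a b : A) (s t : seq A).

Lemma weffD s t : weff (s ++ t) = weff s + weff t.
Proof. by rewrite -wadd_eff. Qed.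

Lemma weffM s t : weff [seq u * v | u <- s, v <- t] = weff s * weff t.
Proof. by rewrite -wmul_eff. Qed.

Lemma weff_sum s : weff s = \sum_(a <- s) teich a.
Proof.
elim: s => [|a s IH]; first by rewrite big_nil -wzero_eff.
by rewrite -cat1s weffD IH big_cat big_seq1.
Qed.

Lemma teich1 : teich 1 = 1 :> witt A.
Proof. by rewrite /teich -wone_eff. Qed.

Lemma teichM a b : teich (a * b) = teich a * teich b.
Proof. by rewrite -weffM. Qed.

Lemma teich_sprods n s : sprods n (map (@teich A) s) = map (@teich A) (sprods n s).
Proof.
elim: s n => [|a s IH] [|n] //=; rewrite ?teich1 //.
rewrite !IH map_cat -!map_comp; congr (_ ++ _); apply: eq_map => p /=.
by rewrite teichM.
Qed.

(** A split series is a sum of the elements [teich a], and [teich] is multiplicative; so the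
    exterior powers become elementary symmetric functions computed inside [witt A]. *)
Lemma wlam_elem n s : wlam n (weff s) = elem n (map (@teich A) s).
Proof. by rewrite wlam_eff weff_sum elem_sprods teich_sprods big_map. Qed.

Lemma wlam_teich n a : (1 < n)%N -> wlam n (teich a) = 0.
Proof. by move=> lt1n; rewrite wlam_elem elem_oversize. Qed.

End Teichmuller.

Lemma natcont_lam n (F : witt_op) :
  natcont F -> natcont (fun A w => wlam n (F A w)).
Proof. by move=> ncF; apply: natcont_op. Qed.

Lemma natcont_sum (I : Type) (r : seq I) (F : I -> witt_op) :
  (forall i, natcont (F i)) -> natcont (fun A w => \sum_(i <- r) F i A w).
Proof.
move=> ncF; elim: r => [|i r IH].
  by apply: natcont_ext (natcont_const _) => A w; rewrite big_nil.
by apply: natcont_ext (natcont_op lconv (ncF i) IH) => A w; rewrite big_cons.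
Qed.

Lemma natcont_int (z : int) : natcont (fun A w => z%:~R).
Proof.
have natr n : natcont (fun A w => n%:R).
  elim: n => [|n IH]; first exact: natcont_const.
  by apply: natcont_ext (natcont_op lconv (natcont_const _) IH) => A w;
     rewrite mulrS.
case: z => n; first exact: natr.
exact: natcont_op (natcont_const _) (natr n.+1).
Qed.

Lemma natcont_leval (fx fy : nat -> witt_op) (Q : lterm) :
  (forall k, natcont (fx k)) -> (forall k, natcont (fy k)) ->
  natcont (fun A w => leval (fun k => fx k A w) (fun k => fy k A w) Q).
Proof.
move=> ncx ncy; elim: Q => //= [z|P IHP Q IHQ|P IHP Q IHQ].
- exact: natcont_int.
- exact: (natcont_op lconv IHP IHQ).
- exact: (natcont_op mul_term IHP IHQ).
Qed.

Section WittLambda.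
Variable A : comNzRingType.

Lemma wlam0 (u : witt A) : wlam 0 u = 1.
Proof.
apply: (@natcont_eq (fun A w => wlam 0 (w 0%N)) (fun A w => 1) _ _ _ _ [:: u]).
- exact/natcont_lam/natcont_var.
- exact: natcont_const.
by move=> B ss; rewrite wlam_elem elem0.
Qed.

Lemma wlam1 (u : witt A) : wlam 1 u = u.
Proof.
apply: (@natcont_eq (fun A w => wlam 1 (w 0%N)) (fun A w => w 0%N)
  _ _ _ _ [:: u]).
- exact/natcont_lam/natcont_var.
- exact: natcont_var.
by move=> B ss; rewrite wlam_eff sprods1.
Qed.

Lemma wlamD n (u v : witt A) :
  wlam n (u + v) = \sum_(i < n.+1) wlam i u * wlam (n - i)%N v.
Proof.
apply: (@natcont_eq (fun A w => wlam n (w 0%N + w 1%N))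
  (fun A w => \sum_(i < n.+1) wlam i (w 0%N) * wlam (n - i)%N (w 1%N))
  _ _ _ _ [:: u; v]).
- by apply: natcont_lam; apply: natcont_op; apply: natcont_var.
- apply: natcont_sum => i; apply: natcont_op; apply: natcont_lam;
  exact: natcont_var.
move=> B ss; rewrite -weffD wlam_elem map_cat elem_cat.
by apply: eq_bigr => i _; rewrite !wlam_elem.
Qed.

(** On split series the universal identity [QP] is used in the ring [witt B] itself, for the lists
    of elements [teich a]. *)
Lemma wlamM n Q (u v : witt A) : mul_univ n Q ->
  wlam n (u * v) = leval (fun k => wlam k u) (fun k => wlam k v) Q.
Proof.
move=> QP.
apply: (@natcont_eq (fun A w => wlam n (w 0%N * w 1%N))
  (fun A w => leval (fun k => wlam k (w 0%N)) (fun k => wlam k (w 1%N)) Q)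
  _ _ _ _ [:: u; v]).
- by apply: natcont_lam; apply: natcont_op; apply: natcont_var.
- by apply: natcont_leval => k; apply: natcont_lam; apply: natcont_var.
move=> B ss; rewrite -weffM wlam_elem.
transitivity (elem n [seq x * y | x <- map (@teich B) (ss 0%N),
                                  y <- map (@teich B) (ss 1%N)]).
  rewrite allpairs_mapl allpairs_mapr map_allpairs.
  by congr (elem n _); apply: eq_allpairs => x y; rewrite teichM.
by rewrite QP; apply: eq_leval => k; rewrite wlam_elem.
Qed.

Lemma wlam_comp m n Q (u : witt A) : comp_univ m n Q ->
  wlam m (wlam n u) = leval (fun k => wlam k u) (fun=> 0) Q.
Proof.
move=> QP.
apply: (@natcont_eq (fun A w => wlam m (wlam n (w 0%N)))
  (fun A w => leval (fun k => wlam k (w 0%N)) (fun=> 0) Q) _ _ _ _ [:: u]).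
- by apply: natcont_lam; apply: natcont_lam; apply: natcont_var.
- apply: (@natcont_leval (fun k A w => wlam k (w 0%N)) (fun k A w => 0)) => k.
    by apply: natcont_lam; apply: natcont_var.
  exact: natcont_const.
move=> B ss; rewrite wlam_eff wlam_elem -teich_sprods QP.
by apply: eq_leval => k //; rewrite wlam_elem.
Qed.

Lemma witt_special : special_lambda (@wlam A).
Proof.
split; first by split; [exact: wlam0|exact: wlam1].
- exact: wlamD.
- by move=> n; rewrite -teich1 wlam_teich.
- by move=> n Q QP u v; apply: wlamM.
- by move=> m n Q QP u; apply: wlam_comp.
Qed.

End WittLambda.

(** * Functoriality of the series ring, from naturality of its operations *)

Section WittFunctor.
Variables (A B : comNzRingType) (f : {rmorphism A -> B}).

Lemma wmap_zmod : zmod_morphism (wmap f).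
Proof.
have wmapD : {morph wmap f : u v / u + v}.
  move=> u v.
  have [nat_add _] := natcont_op lconv (natcont_var 0) (natcont_var 1).
  exact: esym (nat_add A B f (nth 0 [:: u; v])).
(* Negation is multiplication by [wneg1], hence natural as well. *)
have [nat_neg _] := natcont_op mul_term
  (natcont_const (fun k => (-1) ^+ k)) (natcont_var 0).
move=> u v; rewrite wmapD; congr (_ + _).
exact: esym (nat_neg A B f (fun=> v)).
Qed.

Lemma wmap_monoid : monoid_morphism (wmap f).
Proof.
split=> [|u v].
  have [nat1 _] := natcont_const (fun k => (k <= 1)%N%:R).
  exact: esym (nat1 A B f (fun=> 0)).
have [natM _] := natcont_op mul_term (natcont_var 0) (natcont_var 1).
exact: esym (natM A B f (nth 0 [:: u; v])).
Qed.

HB.instance Definition _ :=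
  GRing.isZmodMorphism.Build (witt A) (witt B) (wmap f) wmap_zmod.
HB.instance Definition _ :=
  GRing.isMonoidMorphism.Build (witt A) (witt B) (wmap f) wmap_monoid.

Lemma wmap_lam n (u : witt A) : wmap f (wlam n u) = wlam n (wmap f u).
Proof.
have [nat_lam _] := natcont_lam n (natcont_var 0).
exact: esym (nat_lam A B f (fun=> u)).
Qed.

End WittFunctor.

(** * The canonical morphism from a lambda-ring to its series ring *)

Section LambdaSeries.
Variables (R : comNzRingType) (lam : nat -> R -> R).

Definition lambda_series (x : R) : witt R := wseries (fun k => lam k x).

Hypothesis hR : special_lambda lam.

Lemma wcoef_lambda_series x k : wcoef (lambda_series x) k = lam k x.
Proof. by have [[lam0 _] _ _ _ _] := hR; rewrite wcoef_series. Qed.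

Lemma lambda_seriesD x y :
  lambda_series (x + y) = lambda_series x + lambda_series y.
Proof.
have [_ lamD _ _ _] := hR; apply: witt_ext => -[|k] //=.
by rewrite leval_conv lamD; apply: eq_bigr => i _; rewrite !wcoef_lambda_series.
Qed.

Lemma lambda_series_zmod : zmod_morphism lambda_series.
Proof.
move=> x y; apply: (addIr (lambda_series y)).
by rewrite -lambda_seriesD !subrK.
Qed.

(** Coefficient by coefficient this is the product axiom, together with the axiom that the series of
    1 is 1 + t. *)
Lemma lambda_series_monoid : monoid_morphism lambda_series.
Proof.
have [[_ lam1] _ lam_one lamM _] := hR; split=> [|x y].
  rewrite -teich1; apply: witt_ext => -[|[|k]] //=.
    by rewrite lam1 elem1 big_seq1.
  by rewrite lam_one elem_oversize.
apply: witt_ext => -[|k] //=; rewrite /mul_term; case: cid => Q /= QP.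
by rewrite (lamM _ _ QP); apply: eq_leval => j; rewrite wcoef_lambda_series.
Qed.

Lemma lambda_series_lam n x : lambda_series (lam n x) = wlam n (lambda_series x).
Proof.
have [_ _ _ _ lamC] := hR; apply: witt_ext => -[|k] //=.
rewrite /comp_term; case: cid => Q /= QP; rewrite (lamC _ _ _ QP) leval_subst.
by apply: eq_leval => j //=; rewrite wcoef_lambda_series.
Qed.

Lemma lambda_series_inj : injective lambda_series.
Proof.
have [[_ lam1] _ _ _ _] := hR.
by move=> x y xy; rewrite -(lam1 x) -(lam1 y) -!wcoef_lambda_series xy.
Qed.

End LambdaSeries.

(** * The bound (2,1) and the decomposition into line elements *)

Lemma det_mx22 (R : comNzRingType) (M : 'M[R]_2) :
  \det M = M 0 0 * M 1 1 - M 0 1 * M 1 0.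
Proof.
rewrite (expand_det_row _ 0) !big_ord_recl big_ord0 addr0 /cofactor !det_mx11.
rewrite !mxE /= expr0 mul1r expr1 mulN1r mulrN.
by congr (M _ _ * M _ _ - M _ _ * M _ _); apply: val_inj.
Qed.

(** The hook with rows [2, 1, ..., 1] and [n.+2] rows has conjugate [(n.+2, 1)]; its 2 by 2
    Jacobi-Trudi determinant is [lam n.+2 x * x - lam n.+3 x]. *)
Lemma bound21_lam (R : comNzRingType) (lam : nat -> R -> R) (x : R) n :
  lam 0%N x = 1 -> lam 1%N x = x -> schur_finite_bound lam x [:: 2; 1]%N ->
  lam n.+3 x = x * lam n.+2 x.
Proof.
move=> lam0 lam1 hx; pose p := 2%N :: nseq n.+1 1%N.
have part_p : is_partition p.
  apply/andP; split; last by rewrite /= all_nseq orbT.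
  by rewrite /p /=; elim: (n) => //= j ->.
have p21 : contains p [:: 2; 1]%N by [].
have conj1 : conjp p 1 = n.+2 by rewrite /conjp /= count_nseq mul1n.
have conj2 : conjp p 2 = 1%N by rewrite /conjp /= count_nseq.
have := hx p part_p p21; rewrite /schur [head _ _]/= det_mx22.
rewrite !mxE (conj1 : conjp p (0%R : 'I_2).+1 = n.+2).
rewrite (conj2 : conjp p (1%R : 'I_2).+1 = 1%N) /=.
rewrite modn_small // !addn0 !addn1 !subn1 /= lam0 lam1 mulr1 mulrC.
by move/eqP; rewrite subr_eq0 => /eqP ->.
Qed.

(** Adding [teich a] multiplies the series by 1 + a t. *)
Lemma wcoef_add_teich (A : comNzRingType) (u : witt A) a k :
  wcoef (u + teich a) k.+1 = wcoef u k.+1 + wcoef u k * a.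
Proof.
rewrite [LHS]/= leval_conv 2!big_ord_recr /= subnn mulr1 subSnn.
rewrite big1 ?add0r => [|i _]; last first.
  by rewrite wcoef_eff elem_oversize ?mulr0 //= ltn_subRL addn1 ltnS.
by rewrite addrC wcoef_eff elem1 big_seq1.
Qed.

Theorem theorem4 (R : comNzRingType) (lam : nat -> R -> R)
  (hR : special_lambda lam) (x : R)
  (hx : schur_finite_bound lam x [:: 2%N; 1%N]) :
  exists (R' : comNzRingType) (lam' : nat -> R' -> R') (f : {rmorphism R -> R'}),
    [/\ special_lambda lam',
        injective f,
        (forall n y, f (lam n y) = lam' n (f y)) &
        exists l1 l2 l3 : R',
          [/\ line_elt lam' l1, line_elt lam' l2, line_elt lam' l3 &
              f x = l1 + l2 - l3]].
Proof.
have [[lam0 lam1] _ _ _ _] := hR.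
(* Coefficients of the series of [x] times 1 - x t; the linear one cancels. *)
pose q := nth 0 [:: 1; 0; lam 2 x - x * x].
have [A [g [inj_g [s sz_s sE]]]] := series_splits 2 (erefl : q 0%N = 1).
case: s sz_s sE => [|a [|b [|? ?]]] // _ abE.
pose lamR : {rmorphism R -> witt R} := HB.pack (lambda_series lam)
  (GRing.isZmodMorphism.Build R (witt R) _ (lambda_series_zmod hR))
  (GRing.isMonoidMorphism.Build R (witt R) _ (lambda_series_monoid hR)).
exists (witt A), (@wlam A), (wmap g \o lamR); split.
- exact: witt_special.
- by apply: inj_comp; [exact: wmap_inj|exact: lambda_series_inj hR].
- by move=> n y /=; rewrite (lambda_series_lam hR) wmap_lam.
exists (teich a), (teich b), (teich (- g x)).
split; try by move=> n; apply: wlam_teich.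
(* The subtracted term is moved across, leaving an equality with [weff [:: a; b]] that is checked
   coefficientwise. *)
apply/eqP; rewrite eq_sym subr_eq eq_sym -weffD; apply/eqP.
apply: witt_ext => -[|k] //.
rewrite wcoef_add_teich !wcoef_map !(wcoef_lambda_series hR) wcoef_eff.
rewrite mulrN -rmorphM -rmorphB.
(* Degrees 1 and 2 match by the choice of [q]; from degree 3 on the left side vanishes by the Schur
   bound and the right side because there are only two roots. *)
case: k => [|[|k]].
- by rewrite abE // lam0 lam1 mul1r subrr.
- by rewrite abE // lam1.
by rewrite (bound21_lam _ (lam0 x) (lam1 x) hx) mulrC subrr rmorph0 elem_oversize.
Qed.
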